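(* Let $(W,S)$ be a finite Coxeter system and let $K$ be a self-opposed subset of $S$. Let $\psi_K:\Sigma(W)\to\Sigma(W(K))$ be the $\mathbb{Q}$-linear map such that, for every $I\subset S$, $$\psi_K(x_I)=\begin{cases} x^{(K)}_{I(K)} & \text{if } K\subset I,\\ 0 & \text{otherwise.}\end{cases}$$ Then $\psi_K$ is a surjective homomorphism of algebras.
   Context: Let $(W,S)$ be a finite Coxeter system with length function $\ell$. For $I\subset S$, $W_I$ is the subgroup generated by $I$, $w_I$ is the longest element of $W_I$, $X_I=\{w\in W : \ell(ws)>\ell(w)\ \text{for all } s\in I\}$ and $x_I=\sum_{w\in X_I} w\in\mathbb{Q}W$. The Solomon descent algebra is $\Sigma(W)=\bigoplus_{I\subset S}\mathbb{Q}x_I$; it is a unital subalgebra of the group algebra $\mathbb{Q}W$, with basis $(x_I)_{I\subset S}$ (Solomon). A subset $K\subset S$ is self-opposed if, for every $w\in W$ such that $wKw^{-1}\subset S$, one has $wKw^{-1}=K$. For $K\subset S$ let $W(K)=\{w\in X_K^{-1}\cap X_K : wKw^{-1}=K\}$, a subgroup of $W$. For $K$ self-opposed and $s\in S\setminus K$, put $w_{K,s}=w_{K\cup\{s\}}w_K\in W(K)$, and for $K\subset I\subset S$ put $I(K)=\{w_{K,s} : s\in I\setminus K\}$. Then $(W(K),S(K))$ is a finite Coxeter system (known fact). For $A\subset S(K)$, $x^{(K)}_A$ denotes the basis element of $\Sigma(W(K))$ defined like $x_I$ but for the Coxeter system $(W(K),S(K))$. *)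

(* Defs.v *)
From HB Require Import structures.
From mathcomp Require Import all_boot all_order all_fingroup all_algebra all_field.

Set Implicit Arguments.
Unset Strict Implicit.
Unset Printing Implicit Defensive.

Import GRing.Theory GroupScope.

(* The ambient finite type of group elements is gT; a Coxeter system is a pair
   (W, S) of subsets of gT, so that (W, S) and (W(K), S(K)) are objects of the
   same kind, inside the same ambient group. *)

Section Coxeter.
Variable gT : finGroupType.
Implicit Types (W S I K : {set gT}) (w s : gT).

(* S consists of involutions, generates W, and the relations
   (s * t) ^+ m(s, t) = 1, with m(s, t) the order of s * t, present W: this is
   the universal property, tested on all groups H, finite or not (the case
   s = t gives the relations s ^+ 2 = 1). *)
Definition coxeter_system W S : Prop :=
  [/\ <<S>> = W,
      {in S, forall s, #[s] = 2}
    & forall (H : groupType) (f : gT -> H),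
        {in S &, forall s t, (f s * f t) ^+ #[s * t] = 1} ->
        exists2 phi : gT -> H,
          {in W &, {morph phi : x y / x * y}} & {in S, phi =1 f}].

(* The elements of S ^+ n are the products of n elements of S; gT being finite,
   inverses of elements of S are not needed. *)
Lemma length_subproof S w :
  exists n : nat, (w \in <<S>>) ==> (w \in (S ^+ n)%g).
Proof.
case: (boolP (w \in <<S>>)) => [/gen_prodgP[n [c Sc ->]]|_]; last by exists 0.
exists n; apply/implyP => _.
elim: n c Sc => [|n IHn] c Sc; first by rewrite big_ord0 expg0 inE.
by rewrite big_ord_recl expgS mem_mulg // IHn.
Qed.

(* Meaningful for w \in <<S>>; equal to 0 elsewhere. *)
Definition cox_length S w : nat := ex_minn (length_subproof S w).

Definition coset_reps W S I : {set gT} :=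
  [set w in W | [forall s in I, cox_length S w < cox_length S (w * s)]].

Definition longest S I : gT := [arg max_(w > 1 in <<I>>) cox_length S w].

(* Recall that K :^ x = x^-1 K x. *)
Definition self_opposed W S K : Prop :=
  K \subset S /\
  forall w, w \in W -> K :^ w^-1 \subset S -> K :^ w^-1 = K.

Definition relW W S K : {set gT} :=
  [set w in (coset_reps W S K)^-1 :&: coset_reps W S K | K :^ w^-1 == K].

Definition relgen S K s : gT := longest S (s |: K) * longest S K.

Definition relS S K I : {set gT} := [set relgen S K s | s in I :\: K].

End Coxeter.

Local Open Scope ring_scope.

(* The group algebra of gT over rat: functions under convolution. *)
Section GroupAlgebra.
Variable gT : finGroupType.

Definition grpalg : Type := {ffun gT -> rat}.

HB.instance Definition _ := Vector.copy grpalg {ffun gT -> rat^o}.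

Implicit Types f g h : grpalg.

Definition gelt (w : gT) : grpalg := [ffun x => (x == w)%:R].

Definition gconv f g : grpalg := [ffun w => \sum_u f u * g (u^-1 * w)%g].

Fact gconvA : associative gconv.
Proof.
move=> f g h; apply/ffunP => w; rewrite !ffunE.
under eq_bigr => u _ do rewrite ffunE big_distrr /=.
under [RHS]eq_bigr => v _ do rewrite ffunE big_distrl /=.
rewrite [RHS]exchange_big; apply: eq_bigr => u _ /=.
rewrite [RHS](reindex_inj (mulgI u)) /=; apply: eq_bigr => v _.
by rewrite mulKg invMg !mulgA mulrA.
Qed.

Fact gconv1l : left_id (gelt 1%g) gconv.
Proof.
move=> f; apply/ffunP => w; rewrite !ffunE (bigD1 1%g) //= ffunE eqxx mul1r.
rewrite invg1 mul1g big1 ?addr0 // => u /negPf nu1.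
by rewrite ffunE nu1 mul0r.
Qed.

Fact gconv1r : right_id (gelt 1%g) gconv.
Proof.
move=> f; apply/ffunP => w; rewrite !ffunE (bigD1 w) //= ffunE mulVg eqxx mulr1.
rewrite big1 ?addr0 // => u nuw.
by rewrite ffunE -eq_mulVg1 (negPf nuw) mulr0.
Qed.

Fact gconvDl : left_distributive gconv +%R.
Proof.
move=> f g h; apply/ffunP => w; rewrite !ffunE -big_split /=.
by apply: eq_bigr => u _; rewrite ffunE mulrDl.
Qed.

Fact gconvDr : right_distributive gconv +%R.
Proof.
move=> f g h; apply/ffunP => w; rewrite !ffunE -big_split /=.
by apply: eq_bigr => u _; rewrite ffunE mulrDr.
Qed.

Fact gelt1_neq0 : gelt 1%g != 0.
Proof.
by apply/eqP => /ffunP/(_ 1%g)/eqP; rewrite !ffunE eqxx oner_eq0.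
Qed.

HB.instance Definition _ :=
  GRing.Zmodule_isNzRing.Build grpalg
    gconvA gconv1l gconv1r gconvDl gconvDr gelt1_neq0.

Fact gconvZl (a : rat) f g : a *: (f * g) = a *: f * g.
Proof.
apply/ffunP => w; rewrite !ffunE scaler_sumr.
by apply: eq_bigr => u _; rewrite ffunE /= -[_ *: _]/(a * _) mulrA.
Qed.

HB.instance Definition _ := GRing.Lmodule_isLalgebra.Build rat grpalg gconvZl.

Fact gconvZr (a : rat) f g : a *: (f * g) = f * (a *: g).
Proof.
apply/ffunP => w; rewrite !ffunE scaler_sumr.
by apply: eq_bigr => u _; rewrite ffunE /= -[_ *: _]/(a * _) mulrCA.
Qed.

HB.instance Definition _ := GRing.Lalgebra_isAlgebra.Build rat grpalg gconvZr.
HB.instance Definition _ := Algebra_isFalgebra.Build rat grpalg.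

Lemma geltM u v : gelt (u * v)%g = gelt u * gelt v.
Proof.
apply/ffunP => w; rewrite !ffunE (bigD1 u) //= !ffunE eqxx mul1r.
rewrite big1 ?addr0 => [|x /negPf nxu]; last by rewrite ffunE nxu mul0r.
by rewrite (can2_eq (mulKVg u) (mulKg u)).
Qed.

End GroupAlgebra.

Section Descent.
Variable gT : finGroupType.
Implicit Types (W S I K : {set gT}).

Definition descent_elt W S I : grpalg gT :=
  \sum_(w in coset_reps W S I) gelt w.

Definition descent_algebra W S : {vspace grpalg gT} :=
  (\sum_(I in powerset S) <[descent_elt W S I]>)%VS.

(* A linear map on the subspace descent_algebra W S is represented, as usual
   with 'Hom and ahom_in, by a linear map on the whole group algebra, of which
   only the restriction to that subspace matters. *)
Definition is_psi W S K (psi : 'End(grpalg gT)) : Prop :=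
  forall I, I \subset S ->
    psi (descent_elt W S I) =
      if K \subset I
      then descent_elt (relW W S K) (relS S K S) (relS S K I)
      else 0.

End Descent.

(* Main.v *)
Require Import Defs.
From mathcomp Require Import all_boot all_order all_fingroup all_algebra all_solvable all_field.

(** Why psi_K is an algebra map.  Both multiplication tables are instances of
one formula.  Write Y for W(K), X_I for the minimal representatives of the
cosets w W_I, and y_I for the sum of Y cap X_I.  When K is self-opposed and
K is contained in I and J,

  y_I y_J = sum over d in Y cap X_I^-1 cap X_J of y_(d^-1 I d cap J)

([solomon_rel]).  The case K = set0 is Solomon's formula in W, since then
Y = W and y_I = x_I; in general the proof is Solomon's, because a
self-opposed K forces the minimal representatives of elements of Y to lie in
Y ([min_rep_rel]).  Now apply psi_K to the formula for x_I x_J.  The terms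
that survive are those with K contained in d^-1 I d cap J.  For such a d the
set d K d^-1 lies in I, hence in S, hence is K itself, so that K is contained
in I and d is in Y ([sub_conj_rel]).  What remains is exactly the formula for
y_I y_J, provided that y_I is psi_K(x_I).

That last identity says that Y cap X_I is the set of representatives of
I(K) for the length function of (W(K), S(K)) ([rel_coset_reps]).  Write N(w)
for the set of reflections t with l(tw) < l(w).  For s outside K, the set
N(w_(K,s)) consists of the reflections of W_(K + s) not in W_K, and for w in
Y it is either contained in N(w) or disjoint from it, according to whether
s is in N(w) ([relgen_descent]).  So it behaves like a single
reflection, and the usual criterion of Bourbaki, applied to the condition
that N(w_(K,s)) is contained in N(w), identifies the descents for S(K)
([rel_left_ascent]); the same dichotomy shows that S(K) generates Y
([gen_relS]).

All the Coxeter theory is derived from the cocycle property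
N(uv) = N(u) + u N(v) u^-1 (symmetric difference), which comes from letting
W permute the signed elements (t, b) ([coxeter_inversion_cocycle]).  Finally,
psi_K exists because the x_I are linearly independent: w_(S - I) lies in X_J
exactly when J is contained in I ([longest_coset_reps]), so that evaluation
at the elements w_(S - I) is unitriangular. *)

Set Implicit Arguments.
Unset Strict Implicit.
Unset Printing Implicit Defensive.

Import GRing.Theory GroupScope.

(** * Words in a generating set of involutions *)
Section Words.
Variable gT : finGroupType.
Implicit Types (S : {set gT}) (w s t r : gT).

Lemma sub_expg_gen S n : S ^+ n \subset <<S>>.
Proof.
elim: n => [|n IHn]; first by rewrite expg0 sub1G.
by rewrite expgS mul_subG ?subset_gen.
Qed.

Lemma mem_expg_cox_length S w : w \in <<S>> -> w \in S ^+ cox_length S w.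
Proof. by move=> Ww; rewrite /cox_length; case: ex_minnP => n /implyP->. Qed.

Lemma cox_length_le S n w : w \in S ^+ n -> cox_length S w <= n.
Proof.
by move=> Sw; rewrite /cox_length; case: ex_minnP => m _; apply; rewrite Sw implybT.
Qed.

Definition involutive_gens S := {in S, forall s, #[s] = 2}.

Lemma invol_sqr S s : involutive_gens S -> s \in S -> s * s = 1.
Proof. by move=> S2 /S2 os; rewrite -expg2 -os expg_order. Qed.

Lemma invol_inv S s : involutive_gens S -> s \in S -> s^-1 = s.
Proof. by move=> S2 Ss; apply/eqP; rewrite eq_invg_mul (invol_sqr S2). Qed.

Lemma invol_mulK S s : involutive_gens S -> s \in S -> involutive (mulg s).
Proof. by move=> S2 Ss w; rewrite mulgA (invol_sqr S2) ?mul1g. Qed.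

Lemma invol_conjK S s t : involutive_gens S -> s \in S -> (t ^ s) ^ s = t.
Proof. by move=> S2 Ss; rewrite -conjgM (invol_sqr S2) ?conjg1. Qed.

Lemma cox_lengthV S w :
  involutive_gens S -> w \in <<S>> -> cox_length S w^-1 = cox_length S w.
Proof.
move=> S2.
have SV n x : x \in S ^+ n -> x^-1 \in S ^+ n.
  elim: n x => [|n IHn] x; first by rewrite !expg0 !inE => /eqP->; rewrite invg1.
  rewrite {1}expgS => /mulsgP[s y Ss Sy ->].
  by rewrite invMg (invol_inv S2 Ss) expgSr mem_mulg ?IHn.
have le x : x \in <<S>> -> cox_length S x^-1 <= cox_length S x.
  by move=> /mem_expg_cox_length /SV /cox_length_le.
by move=> Ww; apply/eqP; rewrite eqn_leq le // -{1}[w]invgK le ?groupV.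
Qed.

(** Bourbaki's characterization of Coxeter systems by half-spaces: read
[P r w] as saying that w lies beyond the wall of r.  Along a word for w there
is a letter at which that wall is crossed, and by the third condition this
letter can be traded for r; hence r shortens w as soon as w lies beyond the
wall of r. *)
Lemma cox_length_descent S (P : gT -> gT -> bool) :
    involutive_gens S ->
    {in S, forall r, ~~ P r 1} ->
    {in S & <<S>>, forall r w, P r (r * w) = ~~ P r w} ->
    (forall r w t, r \in S -> w \in <<S>> -> t \in S ->
       ~~ P r w -> P r (w * t) -> r * w = w * t) ->
  {in S & <<S>>, forall r w,
    (cox_length S w < cox_length S (r * w)) = ~~ P r w}.
Proof.
move=> S2 P1 PM Pexch.
have exch r n w : r \in S -> w \in S ^+ n.+1 -> P r w -> r * w \in S ^+ n.
  move=> Sr; elim: n w => [|n IHn] w.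
    rewrite expg1 => Sw Prw.
    have := Pexch r 1 w Sr (group1 _) Sw (P1 r Sr).
    by rewrite mul1g mulg1 => /(_ Prw) ->; rewrite (invol_sqr S2 Sw) expg0 inE.
  rewrite {1}expgSr => /mulsgP[v t Sv St ->] Prw.
  case: (boolP (P r v)) => Prv.
    by rewrite mulgA expgSr mem_mulg // IHn.
  have Wv := subsetP (sub_expg_gen _ _) _ Sv.
  by rewrite mulgA (Pexch _ _ _ Sr Wv St Prv Prw) -mulgA (invol_sqr S2 St) mulg1.
have dec r w : r \in S -> w \in <<S>> -> P r w ->
    cox_length S (r * w) < cox_length S w.
  move=> Sr Ww Prw; have := mem_expg_cox_length Ww.
  case: (cox_length S w) => [|n Sw]; last first.
    by rewrite ltnS; apply/cox_length_le/exch.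
  by rewrite expg0 inE => /eqP w1; have := P1 r Sr; rewrite -w1 Prw.
move=> r w Sr Ww; case: (boolP (P r w)) => Prw /=.
  by apply/negbTE; rewrite -leqNgt ltnW ?dec.
by rewrite -{1}[w](invol_mulK S2 Sr) dec ?PM // groupM ?(mem_gen Sr).
Qed.

End Words.

(** * The inversion cocycle of a Coxeter system *)
Section Cocycle.
Variable gT : finGroupType.
Implicit Types (S : {set gT}) (N : gT -> {set gT}) (w s t r u v : gT).

(** The left inversion sets of a Coxeter system, given by the rule for a
product.  The rule determines N on <<S>> from its values on S, so that any N
with these properties is the set of reflections t for which tw is shorter
than w. *)
Definition inversion_cocycle S N :=
  [/\ involutive_gens S, {in S, forall s, N s = [set s]}
    & {in <<S>> &, forall u v t, (t \in N (u * v)) = (t \in N u) (+) (t ^ u \in N v)}].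

(** A reflection with a sign is a root; multiplying by s permutes the roots,
and changes the sign of the roots of s only.  The action is defined on all
pairs, which spares singling out the reflections. *)
Definition signed_conj s (x : gT * bool) := (x.1 ^ s, x.2 (+) (x.1 == s)).

Lemma signed_conj_inj s : injective (signed_conj s).
Proof. by move=> [t b] [t' b'] [/conjg_inj-> /addIb->]. Qed.

Definition signed_perm s : {perm gT * bool} := perm (@signed_conj_inj s).

(** The sign changes once for each j < 2n such that r = (st)^j s: the even
values of j are the passages at s, the odd ones the passages at t. *)
Lemma signed_perm_pow S s t n r b :
    involutive_gens S -> s \in S -> t \in S ->
  ((signed_perm s * signed_perm t) ^+ n) (r, b) =
    (r ^ ((s * t) ^+ n),
     b (+) odd (\sum_(0 <= j < n.*2) (r == ((s * t) ^+ j * s)%g))).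
Proof.
move=> S2 Ss St; set z := s * t.
have zs m : z ^+ m * s = s * z ^- m.
  rewrite conjgC conjXg [_ ^ s](_ : _ = z^-1) ?expVgn //.
  by rewrite conjgE /z !mulgA mulVg mul1g invMg !(invol_inv S2).
have conjr m y : (r ^ (z ^+ m) == y) = (r == z ^+ m * y * z ^- m).
  by rewrite -(inj_eq (@conjg_inj _ (z ^- m))) conjgK [y ^ _]conjgE invgK mulgA.
elim: n => [|n IHn]; first by rewrite !expg0 perm1 conjg1 big_geq // addbF.
rewrite expgSr permM IHn permM !permE /signed_conj /=; congr (_, _).
  by rewrite -!conjgM -expgSr.
rewrite doubleS !big_nat_recr //= !oddD !oddb -!addbA; congr (_ (+) (_ (+) _)).
have -> : (r ^ z ^+ n == s) = (r == z ^+ n.*2 * s).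
  by rewrite conjr -mulgA -zs mulgA -expgD addnn.
congr (_ (+) _).
rewrite -(inj_eq (@conjg_inj _ s)) (invol_conjK _ S2 Ss) conjr.
rewrite [t ^ s]conjgE (invol_inv S2 Ss) !mulgA -(mulgA (z ^+ n)) -/z.
by rewrite -expgSr -mulgA -zs mulgA -expgD addSn addnn.
Qed.

(** For n the order of st, the 2n elements (st)^j s repeat with period n, so
that every sign changes an even number of times. *)
Lemma signed_perm_relation S :
    involutive_gens S ->
  {in S &, forall s t, (signed_perm s * signed_perm t) ^+ #[s * t] = 1}.
Proof.
move=> S2 s t Ss St; apply/permP => -[r b].
rewrite (signed_perm_pow _ _ _ S2 Ss St) expg_order conjg1 perm1.
rewrite -addnn (big_cat_nat (n := #[s * t])) ?leq_addr //= -{2}[#[s * t]]add0n big_addn.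
rewrite addnK [X in odd (_ + X)](eq_bigr
  (fun j => (r == ((s * t) ^+ j * s)%g) : nat)) => [|j _].
  by rewrite oddD addbb addbF.
by rewrite expgD expg_order mulg1.
Qed.

(** N(w) consists of the t whose positive root becomes negative under w. *)
Lemma coxeter_inversion_cocycle W S :
  coxeter_system W S -> W = <<S>> /\ exists N, inversion_cocycle S N.
Proof.
case=> <- S2 univ; split=> //.
have [phi phiM phiS] := univ _ _ (signed_perm_relation S2).
pose N w := [set t | (phi w (t, false)).2].
have phi1 : phi 1 = 1.
  by apply: (mulgI (phi 1)); rewrite -phiM ?group1 // !mulg1.
have phiE w t b : w \in <<S>> -> phi w (t, b) = (t ^ w, b (+) (t \in N w)).
  move=> /mem_expg_cox_length; move: (cox_length S w) => n.
  elim: n w t b => [|n IHn] w t b.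
    by rewrite expg0 inE => /eqP->; rewrite inE phi1 !perm1 conjg1 addbF.
  rewrite expgS => /mulsgP[s v Ss Sv ->].
  have [Ws Wv] := (mem_gen Ss, subsetP (sub_expg_gen _ _) _ Sv).
  rewrite inE phiM // !permM (phiS s Ss) !permE /signed_conj /= !IHn //=.
  by rewrite conjgM addbA.
exists N; split=> // [s Ss|u v Wu Wv t].
  by apply/setP => t; rewrite !inE (phiS s Ss) permE.
by rewrite {1}/N inE phiM // permM !phiE //= addFb.
Qed.

End Cocycle.

(** * Descents and parabolic subgroups *)
Section Inversions.
Variables (gT : finGroupType) (S : {set gT}) (N : gT -> {set gT}).
Hypothesis cocN : inversion_cocycle S N.
Implicit Types (I K : {set gT}) (a b k r s t u v w : gT).

Let W := <<S>>.

Let S2 : involutive_gens S. Proof. by case: cocN. Qed.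

Lemma inv_gen s t : s \in S -> (t \in N s) = (t == s).
Proof. by case: cocN => _ NS _ /NS->; rewrite inE. Qed.

Lemma invM u v t :
  u \in W -> v \in W -> (t \in N (u * v)) = (t \in N u) (+) (t ^ u \in N v).
Proof. by case: cocN => _ _ NM Wu Wv; apply: NM. Qed.

Lemma inv1 t : (t \in N 1) = false.
Proof. by have := invM t (group1 _) (group1 _); rewrite mulg1 conjg1 addbb. Qed.

Lemma invV u t : u \in W -> (t \in N u^-1) = (t ^ u^-1 \in N u).
Proof.
move=> Wu; have WV : u^-1 \in W by rewrite groupV.
by have := invM t WV Wu; rewrite mulVg inv1; do 2!case: (_ \in _).
Qed.

Lemma sub_parabolic I : I \subset S -> <<I>> \subset W.
Proof. exact: genS. Qed.

(** If t is not the first letter of the word, then t conjugated by that letter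
is an inversion of the rest, and the induction hypothesis applies to it. *)
Lemma strong_exchange I n w t :
  I \subset S -> w \in I ^+ n.+1 -> t \in N w -> t * w \in I ^+ n.
Proof.
move=> sIS; have sIW m := subset_trans (sub_expg_gen I m) (sub_parabolic sIS).
elim: n w t => [|n IHn] w t; rewrite {1}expgS => /mulsgP[s v Is Iv ->];
  have Ss := subsetP sIS s Is; have Wv := subsetP (sIW _) v Iv;
  rewrite invM ?(mem_gen Ss) // (inv_gen _ Ss); case: eqP => [-> _ | _ /= tv];
  rewrite ?(invol_mulK S2 Ss) //.
  by case/negP: tv; move: Iv; rewrite expg0 inE => /eqP->; rewrite inv1.
by rewrite mulgA (conjgC t) -mulgA expgS mem_mulg ?IHn.
Qed.

Lemma cox_length_lt w t :
  w \in W -> t \in N w -> cox_length S (t * w) < cox_length S w.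
Proof.
move=> /mem_expg_cox_length; case: (cox_length S w) => [|n] Sw tw.
  by case/negP: tw; move: Sw; rewrite expg0 inE => /eqP->; rewrite inv1.
by rewrite ltnS; apply/cox_length_le/strong_exchange.
Qed.

Lemma inv_reflection s c : s \in S -> c \in W -> s ^ c \in N (s ^ c).
Proof.
move=> Ss Wc; rewrite {2}conjgE !invM ?groupM ?groupV ?(mem_gen Ss) //.
rewrite (inv_gen _ Ss) conjgK eqxx [s ^ s]conjgE mulKg.
by rewrite invV // conjgK addTb addbN; case: (s \in N c).
Qed.

(** A reflection t is an inversion of itself, hence by the cocycle rule of
exactly one of w and tw. *)
Lemma cox_length_gt w s c : s \in S -> c \in W -> w \in W ->
  s ^ c \notin N w -> cox_length S w < cox_length S (s ^ c * w).
Proof.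
move=> Ss Wc Ww tw; have Wt : s ^ c \in W by rewrite groupJ ?(mem_gen Ss).
rewrite -{1}[w](mulKg (s ^ c)) -conjVg (invol_inv S2 Ss).
have Wtw := groupM Wt Ww; rewrite cox_length_lt // invM // inv_reflection //.
by rewrite [_ ^ (s ^ c)]conjgE mulKg (negPf tw).
Qed.

Lemma left_ascent w s :
  s \in S -> w \in W -> (cox_length S w < cox_length S (s * w)) = (s \notin N w).
Proof.
move=> Ss Ww; case: (boolP (s \in N w)) => sw /=.
  by apply/negbTE; rewrite -leqNgt ltnW ?cox_length_lt.
by rewrite -[s]conjg1 cox_length_gt ?group1 ?conjg1.
Qed.

Lemma right_ascent w s : s \in S -> w \in W ->
  (cox_length S w < cox_length S (w * s)) = (s \notin N w^-1).
Proof.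
move=> Ss Ww; rewrite -(cox_lengthV S2) // -(cox_lengthV S2 (groupM _ (mem_gen Ss))) //.
by rewrite invMg (invol_inv S2 Ss) left_ascent ?groupV.
Qed.

Lemma coset_repsP I w : I \subset S ->
  reflect (w \in W /\ {in I, forall s, s \notin N w^-1}) (w \in coset_reps W S I).
Proof.
move=> sIS; rewrite inE; apply: (iffP andP) => -[Ww].
  move=> /forall_inP H; split=> // s Is.
  by rewrite -right_ascent ?H // (subsetP sIS).
by move=> H; split=> //; apply/forall_inP => s Is; rewrite right_ascent ?H ?(subsetP sIS).
Qed.

Definition parabolic_refl I : {set gT} := class_support I <<I>>.

Lemma parabolic_refl_sub I : parabolic_refl I \subset <<I>>.
Proof. exact: class_support_subG (subset_gen I). Qed.

Lemma parabolic_reflJ I t c :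
  c \in <<I>> -> (t ^ c \in parabolic_refl I) = (t \in parabolic_refl I).
Proof. by move=> Ic; rewrite /parabolic_refl -{1}(class_supportGidr I Ic) memJ_conjg. Qed.

Lemma mem_parabolic_refl I s : s \in I -> s \in parabolic_refl I.
Proof. exact: mem_class_support. Qed.

Lemma inv_sub_refl I a : I \subset S -> a \in <<I>> -> N a \subset parabolic_refl I.
Proof.
move=> sIS; have sIW := subsetP (sub_parabolic sIS).
move=> /mem_expg_cox_length; move: (cox_length I a) => n.
elim: n a => [|n IHn] a.
  by rewrite expg0 inE => /eqP->; apply/subsetP => t; rewrite inv1.
rewrite expgS => /mulsgP[s v Is Iv ->].
have Iv' := subsetP (sub_expg_gen _ _) _ Iv; have Ss := subsetP sIS s Is.
apply/subsetP => t; rewrite invM ?(mem_gen Ss) ?sIW // (inv_gen _ Ss).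
case: eqP => [-> _|_ /(subsetP (IHn v Iv))]; first exact: mem_parabolic_refl.
by rewrite parabolic_reflJ ?mem_gen.
Qed.

Lemma inv_sub_parabolic I a t : I \subset S -> a \in <<I>> -> t \in N a -> t \in <<I>>.
Proof.
by move=> sIS Ia /(subsetP (inv_sub_refl sIS Ia))/(subsetP (parabolic_refl_sub I)).
Qed.

(** The first letter of a word of minimal length over I is a left descent:
otherwise it would be one of the remaining word, which could be shortened. *)
Lemma parabolic_descent I a :
  I \subset S -> a \in <<I>> -> {in I, forall s, s \notin N a} -> a = 1.
Proof.
move=> sIS Ia noI; have := mem_expg_cox_length Ia.
case Dn: (cox_length I a) => [|n]; first by rewrite expg0 inE => /eqP.
rewrite expgS => /mulsgP[s v Is Iv Da]; have Ss := subsetP sIS s Is.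
have Wv := subsetP (subset_trans (sub_expg_gen I n) (sub_parabolic sIS)) v Iv.
have := noI s Is; rewrite Da invM ?(mem_gen Ss) // (inv_gen _ Ss) eqxx conjgE mulKg.
rewrite addTb negbK => sv.
suff : cox_length I a <= n by rewrite Dn ltnn.
have {Iv} := Iv; case: n {Dn} => [|n] Iv.
  by case/negP: sv; move: Iv; rewrite expg0 inE => /eqP->; rewrite inv1.
by rewrite Da (leq_trans (cox_length_le (strong_exchange sIS Iv sv))).
Qed.

Lemma inv_eq1 w : w \in W -> (forall t, t \notin N w) -> w = 1.
Proof. by move=> Ww noN; apply: (@parabolic_descent S). Qed.

Lemma gen_in_parabolic I s : I \subset S -> s \in S -> s \in <<I>> -> s \in I.
Proof.
move=> sIS Ss Is; apply/contraT => nIs.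
have s1 : s = 1.
  apply: (parabolic_descent sIS Is) => t It; rewrite (inv_gen _ Ss).
  by apply: contra nIs => /eqP<-.
by have := S2 Ss; rewrite s1 order1.
Qed.

(** An element of minimal length in the coset W_I v has no inversion in W_I,
by strong exchange. *)
Lemma parabolic_decomp I v : I \subset S -> v \in W ->
  exists b v0, [/\ b \in <<I>>, v0 \in W, v = b * v0
    & {in <<I>>, forall t, t \notin N v0}].
Proof.
move=> sIS Wv; have sIW := subsetP (sub_parabolic sIS).
case: (@arg_minnP _ v [in <<I>> :* v] (cox_length S)); first exact: rcoset_refl.
move=> v0 /rcosetP[b Ib ->] min_v0; exists b^-1, (b * v).
have Wbv := groupM (sIW _ Ib) Wv; rewrite groupV Ib mulKg; split=> // t It; apply/negP => tv0.
have := cox_length_lt Wbv tv0; rewrite ltnNge min_v0 //.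
by rewrite mulgA mem_rcoset mulgK groupM.
Qed.

Lemma invMl I b v0 t : I \subset S -> b \in <<I>> -> v0 \in W ->
    {in <<I>>, forall t, t \notin N v0} ->
  t \in <<I>> -> (t \in N (b * v0)) = (t \in N b).
Proof.
move=> sIS Ib Wv0 nv0 It; have Wb := subsetP (sub_parabolic sIS) b Ib.
by rewrite invM // (negPf (nv0 _ (groupJ It Ib))) addbF.
Qed.

(** An element without descents in I is the minimal element of its coset. *)
Lemma no_descent_parabolic I v : I \subset S -> v \in W ->
  {in I, forall s, s \notin N v} -> {in <<I>>, forall t, t \notin N v}.
Proof.
move=> sIS Wv nI; have [b [v0 [Ib Wv0 Dv nv0]]] := parabolic_decomp sIS Wv.
suff b1 : b = 1 by rewrite Dv b1 mul1g.
apply: (parabolic_descent sIS Ib) => s Is.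
by rewrite -(invMl sIS Ib Wv0 nv0) ?mem_gen // -Dv nI.
Qed.

Lemma longest_mem I : longest S I \in <<I>>.
Proof. by rewrite /longest; case: arg_maxnP; rewrite ?group1. Qed.

(** A reflection of W_I that is not an inversion of w lengthens w, which is
impossible when w is longest. *)
Lemma inv_longest I : I \subset S -> N (longest S I) = parabolic_refl I.
Proof.
move=> sIS; have sIW := subsetP (sub_parabolic sIS).
apply/eqP; rewrite eqEsubset inv_sub_refl ?longest_mem //=.
apply/subsetP => t Tt; apply/contraT; rewrite /longest.
case: arg_maxnP => [|w Iw max_w tw]; first exact: group1.
have It := subsetP (parabolic_refl_sub I) _ Tt.
have := max_w (t * w) (groupM It Iw).
rewrite /= leqNgt; case/imset2P: Tt tw => s c Is Ic -> tw.
by rewrite cox_length_gt ?(subsetP sIS s Is) ?sIW.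
Qed.

Lemma longest_invol I : I \subset S -> (longest S I)^-1 = longest S I.
Proof.
move=> sIS; have Iw := longest_mem I; have Ww := subsetP (sub_parabolic sIS) _ Iw.
apply/eqP; rewrite eq_invg_mul; apply/eqP/inv_eq1 => [|t]; first exact: groupM.
by rewrite invM // inv_longest // parabolic_reflJ // addbb.
Qed.

(** Computing with the cocycle, w_I s w_I has itself as only inversion, so
that it is a generator. *)
Lemma longest_conj I s : I \subset S -> s \in I -> s ^ longest S I \in I.
Proof.
move=> sIS Is; set w := longest S I; have Iw : w \in <<I>> := longest_mem I.
have Ww := subsetP (sub_parabolic sIS) _ Iw; have Ss := subsetP sIS s Is.
have wV : w^-1 = w := longest_invol sIS; have Nw := inv_longest sIS.
have Wsw := groupM (mem_gen Ss) Ww.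
have Nsw t : (t \in N (s ^ w)) = (t == s ^ w).
  rewrite [s ^ w as X in N X]conjgE wV invM // invM ?(mem_gen Ss) // (inv_gen _ Ss).
  rewrite Nw !parabolic_reflJ ?(mem_gen Is) // addbCA addbb addbF.
  by rewrite -[in RHS]wV (can2_eq (conjgK w) (conjgKV w)).
apply/contraT => nIsw.
suff : s ^ w = 1 by move/eqP; rewrite conjg_eq1 -order_eq1 (S2 Ss).
apply: (parabolic_descent sIS); first by rewrite groupJ ?(mem_gen Is).
by move=> t It; rewrite Nsw; apply: contra nIsw => /eqP<-.
Qed.

(** The component b of w in W_I has all of I as left descents, so that
w_I b has no left descent in I; therefore b = w_I, and every reflection of W_I
is an inversion. *)
Lemma full_descent I w : I \subset S -> w \in W ->
  I \subset N w -> parabolic_refl I \subset N w.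
Proof.
move=> sIS Ww sIN; have [b [v0 [Ib Wv0 Dw nv0]]] := parabolic_decomp sIS Ww.
set x := longest S I; have Ix : x \in <<I>> := longest_mem I.
have Wx := subsetP (sub_parabolic sIS) _ Ix.
have Wb := subsetP (sub_parabolic sIS) _ Ib.
have Db : x * b = 1.
  apply: (parabolic_descent sIS (groupM Ix Ib)) => s Is.
  rewrite invM // inv_longest // mem_parabolic_refl //= -(invMl sIS Ib Wv0 nv0).
    by rewrite -Dw (subsetP sIN) ?longest_conj.
  by rewrite mem_gen ?longest_conj.
have xV : x^-1 = x := longest_invol sIS.
have {}Db : b = x by apply/eqP; rewrite eq_sym -xV eq_invg_mul Db.
apply/subsetP => t Tt; have It := subsetP (parabolic_refl_sub I) _ Tt.
by rewrite Dw (invMl sIS Ib Wv0 nv0) // Db inv_longest.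
Qed.

(** A reflection k^u in W_I has some left descent s in I.  As u is minimal
in u W_I, the reflection u s u^-1 is an inversion of u k^u but not of u.  Since
u k^u = k u, this forces u s u^-1 = k. *)
Lemma conj_gen_in I u k : I \subset S -> u \in W ->
    {in I, forall s, s \notin N u^-1} ->
  k \in S -> k ^ u \in <<I>> -> k ^ u \in I.
Proof.
move=> sIS Wu nI Sk Ir; have Wk := mem_gen Sk; have WV : u^-1 \in W by rewrite groupV.
have {}nI := no_descent_parabolic sIS WV nI.
have Wr := subsetP (sub_parabolic sIS) _ Ir.
case: (boolP [exists s in I, s \in N (k ^ u)]) => [/exists_inP[s Is sr]|]; last first.
  rewrite negb_exists_in => /forall_inP/(parabolic_descent sIS Ir)/eqP.
  by rewrite conjg_eq1 -order_eq1 (S2 Sk).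
have Is' := mem_gen Is.
have NuV t : (t ^ u \in N u^-1) = (t \in N u) by rewrite invV ?conjgK.
have := invM (s ^ u^-1) Wu Wr; rewrite conjgKV sr -[in LHS]conjgC.
(* The left-hand side says that u s u^-1 is an inversion of k u. *)
rewrite invM // (inv_gen _ Sk) -NuV conjgKV (negPf (nI _ Is')).
case: eqP => [<-|_ /=]; first by rewrite conjgKV.
rewrite -NuV -[_ ^ u]conjgM (conjgC k) conjgM conjgKV.
by rewrite (negPf (nI _ (groupJ Is' Ir))).
Qed.

(** The representative of g W_I in X_I; it exists for every g in W, so that the
default value is irrelevant there. *)
Definition min_rep I g :=
  odflt 1 [pick u in coset_reps W S I | u^-1 * g \in <<I>>].

Lemma min_repP I g u : I \subset S -> g \in W ->
  (min_rep I g == u) = (u \in coset_reps W S I) && (u^-1 * g \in <<I>>).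
Proof.
move=> sIS Wg; have sIW := subsetP (sub_parabolic sIS).
rewrite /min_rep; case: pickP => [u' /andP[XIu' Iu'] | noX] /=; last first.
  have WVg : g^-1 \in W by rewrite groupV.
  have [b [v [Ib Wv Dg nv]]] := parabolic_decomp sIS WVg.
  have /andP[] := noX v^-1; split.
    by apply/(coset_repsP _ sIS); rewrite groupV invgK; split=> // s /mem_gen/nv.
  by rewrite invgK -[g]invgK Dg invMg mulKVg groupV.
apply/eqP/andP=> [<- // | [XIu Iu]]; apply/eqP; rewrite eq_mulVg1.
have [Wu nu] := coset_repsP u sIS XIu; have [Wu' nu'] := coset_repsP u' sIS XIu'.
have WVu : u^-1 \in W by rewrite groupV.
have Ia : u'^-1 * u \in <<I>>.
  have -> : u'^-1 * u = (u'^-1 * g) * (u^-1 * g)^-1.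
    by rewrite invMg invgK mulgA mulgK.
  by rewrite groupM ?groupV.
apply/eqP/(parabolic_descent sIS Ia) => s Is; have := nu' s Is.
rewrite -{1}[u'^-1](mulgK u) (invM _ (sIW _ Ia) WVu).
by rewrite (negPf (no_descent_parabolic sIS WVu nu _)) ?addbF ?groupJ ?(mem_gen Is).
Qed.

(** * The group W(K) of a self-opposed subset K *)
Section SelfOpposed.
Variable K : {set gT}.
Hypothesis soK : self_opposed W S K.

Let Y := relW W S K.
Let SK := relS S K S.
Let r := relgen S K.

Let sKS : K \subset S. Proof. by case: soK. Qed.

Lemma relWP w :
  reflect [/\ w \in W, K :^ w = K & {in K, forall s, s \notin N w}] (w \in Y).
Proof.
have KV x : (K :^ x^-1 == K) = (K :^ x == K).
  by rewrite (can2_eq (conjsgKV x) (conjsgK x)) eq_sym.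
rewrite inE in_setI mem_invg.
apply: (iffP andP) => [[/andP[]] | [Ww KwK nK]].
  move=> /(coset_repsP _ sKS)[_ nK] /(coset_repsP _ sKS)[Ww _] /eqP.
  by move/eqP; rewrite KV => /eqP; split=> // s Ks; rewrite -[w]invgK nK.
rewrite KV KwK eqxx; split=> //; apply/andP; split.
  by apply/(coset_repsP _ sKS); rewrite invgK groupV.
apply/(coset_repsP _ sKS); split=> // s Ks.
by rewrite invV // nK // -(memJ_conjg K w) conjgKV KwK.
Qed.

Lemma relW_group_set : group_set Y.
Proof.
apply/group_setP; split.
  by apply/relWP; rewrite group1 conjsg1; split=> // s _; rewrite inv1.
move=> u v /relWP[Wu KuK nu] /relWP[Wv KvK nv].
apply/relWP; rewrite groupM // conjsgM KuK KvK; split=> // s Ks.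
by rewrite invM // (negPf (nu s Ks)) nv // -KuK memJ_conjg.
Qed.

Canonical relW_group := Group relW_group_set.

Lemma relW_sub : Y \subset W.
Proof. by apply/subsetP => w /relWP[]. Qed.

Lemma norm_parabolic_refl w t :
  K :^ w = K -> (t ^ w \in parabolic_refl K) = (t \in parabolic_refl K).
Proof.
have impl x y : K :^ x = K -> y \in parabolic_refl K -> y ^ x \in parabolic_refl K.
  move=> KxK /imset2P[k c Kk Kc ->]; rewrite conjJg memJ_class_support //.
    by rewrite -KxK memJ_conjg.
  by rewrite -[K in <<K>>]KxK genJ memJ_conjg.
move=> KwK; apply/idP/idP; last exact: impl.
by rewrite -{2}[t](conjgK w); apply: impl; rewrite -{1}KwK conjsgK.
Qed.

Lemma relW_no_parabolic w t : w \in Y -> t \in <<K>> -> t \notin N w.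
Proof. by case/relWP=> Ww _ nK; apply: no_descent_parabolic t. Qed.

Lemma sub_setU1 s : s \in S -> s |: K \subset S.
Proof. by move=> Ss; rewrite subUset sub1set Ss. Qed.

Lemma longest_norm I : I \subset S -> I :^ longest S I = I.
Proof.
move=> sIS; apply/eqP; rewrite eqEcard cardJg leqnn andbT.
by apply/subsetP => _ /imsetP[s Is ->]; apply: longest_conj.
Qed.

(** Conjugation by w_(K + s) permutes K + s, so that it maps K into S;
self-opposedness then says that it fixes K. *)
Lemma longestU1_norm s : s \in S -> K :^ longest S (s |: K) = K.
Proof.
move=> Ss; have sIS := sub_setU1 Ss; have [_ soK2] := soK.
rewrite -(longest_invol sIS); apply: soK2.
  exact: subsetP (sub_parabolic sIS) _ (longest_mem _).
rewrite longest_invol //; apply: (subset_trans _ sIS).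
by rewrite -{2}(longest_norm sIS) conjSg subsetUr.
Qed.

Lemma relgen_norm s : s \in S -> K :^ r s = K.
Proof. by move=> Ss; rewrite /r /relgen conjsgM longestU1_norm // longest_norm. Qed.

Lemma relgen_parabolic s : r s \in <<s |: K>>.
Proof.
by rewrite groupM ?longest_mem // (subsetP (genS (subsetUr _ _))) ?longest_mem.
Qed.

(** As w_(K + s) normalizes K, the cocycle rule removes from the inversions of
w_(K + s) exactly those of w_K. *)
Lemma inv_relgen s t : s \in S ->
  (t \in N (r s)) = (t \in parabolic_refl (s |: K)) && (t \notin parabolic_refl K).
Proof.
move=> Ss; have sIS := sub_setU1 Ss.
have sub : parabolic_refl K \subset parabolic_refl (s |: K).
  by rewrite /parabolic_refl imset2S ?genS ?subsetUr.
have Wl I : I \subset S -> longest S I \in W.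
  by move/sub_parabolic/subsetP; apply; apply: longest_mem.
rewrite invM ?Wl // !inv_longest // norm_parabolic_refl ?longestU1_norm //.
by case: (boolP (t \in parabolic_refl K)) => [/(subsetP sub)->|]; rewrite ?andbT ?addbF.
Qed.

Lemma gen_not_parabolic s : s \in S :\: K -> s \notin parabolic_refl K.
Proof.
case/setDP=> Ss; apply: contra => /(subsetP (parabolic_refl_sub K)).
exact: gen_in_parabolic.
Qed.

Lemma mem_inv_relgen s : s \in S :\: K -> s \in N (r s).
Proof.
move=> SKs; have [Ss _] := setDP SKs.
by rewrite inv_relgen // mem_parabolic_refl ?setU11 // gen_not_parabolic.
Qed.

Lemma relgen_rel s : s \in S -> r s \in Y.
Proof.
move=> Ss; have sIS := sub_setU1 Ss.
apply/relWP; split; rewrite ?relgen_norm //.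
  exact: subsetP (sub_parabolic sIS) _ (relgen_parabolic s).
by move=> k Kk; rewrite inv_relgen // negb_and negbK (mem_parabolic_refl Kk) orbT.
Qed.

Lemma inv_relgenJ s t : s \in S -> (t ^ r s \in N (r s)) = (t \in N (r s)).
Proof.
move=> Ss; rewrite !inv_relgen // parabolic_reflJ ?relgen_parabolic //.
by rewrite norm_parabolic_refl ?relgen_norm.
Qed.

Lemma relgen_sqr s : s \in S -> r s * r s = 1.
Proof.
move=> Ss; have Wr := subsetP relW_sub _ (relgen_rel Ss).
apply: inv_eq1 => [|t]; first exact: groupM.
by rewrite invM // inv_relgenJ // addbb.
Qed.

(** If s is a left descent of w, then w w_K, whose inversions are those of w
together with the reflections of W_K, has all of K + s as left descents, and
[full_descent] applies.  Otherwise w has no left descent in K + s at all. *)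
Lemma relgen_descent w s t : w \in Y -> s \in S :\: K ->
  t \in N (r s) -> (t \in N w) = (s \in N w).
Proof.
move=> Yw SKs; have [Ss _] := setDP SKs; have sIS := sub_setU1 Ss.
have /relWP[Ww KwK nK] := Yw.
rewrite inv_relgen // => /andP[Tt nTt].
case: (boolP (s \in N w)) => sw; last first.
  apply/negbTE; apply: (no_descent_parabolic sIS Ww); last first.
    exact: subsetP (parabolic_refl_sub _) _ Tt.
  by move=> y /setU1P[-> //|/nK].
have Wx : longest S K \in W by rewrite (subsetP (sub_parabolic sKS)) ?longest_mem.
have invx y : (y \in N (w * longest S K)) = (y \in N w) (+) (y \in parabolic_refl K).
  by rewrite invM // inv_longest // norm_parabolic_refl.
have /subsetP/(_ t Tt) : parabolic_refl (s |: K) \subset N (w * longest S K).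
  apply: (full_descent sIS (groupM Ww Wx)); apply/subsetP => y; rewrite invx.
  case/setU1P=> [->|Ky]; first by rewrite sw (negPf (gen_not_parabolic SKs)).
  by rewrite (negPf (nK y Ky)) mem_parabolic_refl.
by rewrite invx (negPf nTt) addbF.
Qed.

(** Such a y has the same inversions as the involution w_(K,s). *)
Lemma relgen_unique y s :
  y \in Y -> s \in S :\: K -> y \in <<s |: K>> -> y != 1 -> y = r s.
Proof.
move=> Yy SKs Iy ny1; have [Ss _] := setDP SKs; have sIS := sub_setU1 Ss.
have /relWP[Wy _ nK] := Yy; have Wr := subsetP relW_sub _ (relgen_rel Ss).
have sy : s \in N y.
  apply: contraR ny1 => nsy; apply/eqP/(parabolic_descent sIS Iy).
  by move=> k /setU1P[-> //|/nK].
have Ny t : (t \in N y) = (t \in N (r s)).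
  apply/idP/idP => [ty | /(relgen_descent Yy SKs)->//].
  rewrite inv_relgen // (subsetP (inv_sub_refl sIS Iy)) //=.
  apply: contraL ty => /(subsetP (parabolic_refl_sub _)).
  exact: relW_no_parabolic.
have /eqP : r s * y = 1.
  apply: inv_eq1 => [|t]; first exact: groupM.
  by rewrite invM // Ny inv_relgenJ // addbb.
by rewrite -eq_invg_mul => /eqP<-; apply/eqP; rewrite eq_invg_mul relgen_sqr.
Qed.

Lemma relS_invol : involutive_gens SK.
Proof.
move=> _ /imsetP[s SKs ->]; have [Ss _] := setDP SKs.
apply: nt_prime_order; rewrite // ?expg2 ?relgen_sqr //.
by apply: contraL (mem_inv_relgen SKs) => /eqP rs1; rewrite /r rs1 inv1.
Qed.

Lemma relM_descent w s t : w \in Y -> s \in S :\: K ->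
  (t \in N (r s * w)) = (t \in N (r s)) (+) (t ^ r s \in N w).
Proof.
move=> Yw SKs; have [Ss _] := setDP SKs.
by rewrite invM ?(subsetP relW_sub) ?relgen_rel.
Qed.

(** Every nontrivial w in W(K) has a descent s, necessarily outside K.  Then
N(w_(K,s)) is contained in N(w), and multiplying by w_(K,s) removes it. *)
Lemma gen_relS : <<SK>> = Y.
Proof.
apply/eqP; rewrite eqEsubset gen_subG; apply/andP; split.
  by apply/subsetP => _ /imsetP[s /setDP[Ss _] ->]; apply: relgen_rel.
apply/subsetP => w; have [n] := ubnP #|N w|; elim: n w => // n IHn w lewn Yw.
have /relWP[Ww _ nK] := Yw.
have [|] := boolP [exists s in S, s \in N w]; last first.
  rewrite negb_exists_in => /forall_inP/(parabolic_descent (subxx _) Ww)->.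
  exact: group1.
case/exists_inP => s Ss sw; have SKs : s \in S :\: K.
  by rewrite inE Ss andbT; apply: contraL sw => /nK.
have [Yr Sr] : r s \in Y /\ r s \in SK by rewrite relgen_rel ?imset_f.
rewrite -[w]mul1g -(relgen_sqr Ss) -mulgA groupM ?(mem_gen Sr) //.
apply: IHn; last exact: groupM.
have NrN t : t \in N (r s * w) -> t \notin N (r s) /\ t ^ r s \in N w.
  rewrite relM_descent //; case: (boolP (t \in N (r s))) => //= tr.
  by rewrite (relgen_descent Yw SKs) ?sw // inv_relgenJ.
rewrite -ltnS (leq_trans _ lewn) // ltnS -(cardJg _ (r s)) proper_card //.
apply/properP; split; first by apply/subsetP => _ /imsetP[t /NrN[_ tw] ->].
exists s => //; apply/imsetP => -[t /NrN[]].
by rewrite -inv_relgenJ // => /negP nt _ Dt; apply: nt; rewrite -Dt mem_inv_relgen.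
Qed.

Lemma relgen_sub w s : w \in Y -> s \in S :\: K -> (N (r s) \subset N w) = (s \in N w).
Proof.
move=> Yw SKs; apply/subsetP/idP => [-> // | sw t tr]; first exact: mem_inv_relgen.
by rewrite (relgen_descent Yw SKs).
Qed.

(** The conjugate of w_(K,s) by w is a nontrivial element of W(K) lying in
W_(K + s'), and w_(K,s') is the only one. *)
Lemma relgen_conj w s s' : w \in Y -> s \in S :\: K -> s' \in S :\: K ->
  s ^ w \in <<s' |: K>> -> r s * w = w * r s'.
Proof.
move=> Yw SKs SKs' Isw; have [Ss _] := setDP SKs; have /relWP[_ KwK _] := Yw.
rewrite conjgC; congr (_ * _); apply: relgen_unique => //.
- by rewrite groupJ ?relgen_rel.
- have: r s ^ w \in <<s |: K>> :^ w by rewrite memJ_conjg relgen_parabolic.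
  apply: subsetP; rewrite -genJ gen_subG; apply/subsetP => _ /imsetP[k sKk ->].
  case/setU1P: sKk => [-> // | Kk]; rewrite mem_gen // inE -{1}KwK memJ_conjg.
  by rewrite Kk orbT.
rewrite conjg_eq1; apply: contraL (mem_inv_relgen SKs) => /eqP->.
by rewrite inv1.
Qed.

(** [cox_length_descent] with the half-spaces of the w_(K,s) in W(K); the
exchange condition is [relgen_conj]. *)
Lemma rel_left_ascent w s : w \in Y -> s \in S :\: K ->
  (cox_length SK w < cox_length SK (r s * w)) = (s \notin N w).
Proof.
move=> Yw SKs; rewrite -relgen_sub //.
apply: (cox_length_descent (P := fun q x => N q \subset N x) relS_invol);
  rewrite ?gen_relS //; last exact: imset_f.
- move=> _ /imsetP[t SKt ->]; apply/negP => /subsetP/(_ t (mem_inv_relgen SKt)).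
  by rewrite inv1.
- move=> _ x /imsetP[t SKt ->] Yx; have [St _] := setDP SKt.
  have Yrx := groupM (relgen_rel St) Yx; rewrite -/(r t) !relgen_sub //.
  rewrite relM_descent // mem_inv_relgen //.
  by rewrite (relgen_descent Yx SKt) // inv_relgenJ ?mem_inv_relgen.
move=> _ x _ /imsetP[t SKt ->] Yx /imsetP[t' SKt' ->].
have [St' _] := setDP SKt'; have sIS := sub_setU1 St'.
have Yr' := relgen_rel St'; have [Wx Wr'] := (subsetP relW_sub _ Yx, subsetP relW_sub _ Yr').
have Yxr := groupM Yx Yr'; rewrite -/(r t) -/(r t') !relgen_sub // => ntx.
rewrite invM // (negPf ntx) /= => txr.
apply: relgen_conj => //; apply: inv_sub_parabolic sIS _ txr.
exact: relgen_parabolic.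
Qed.

(** Elements of W(K) have no descent in K, so that only the s in I outside K
matter in X_I; for these, [rel_left_ascent] compares the two lengths. *)
Lemma rel_coset_reps I : K \subset I -> I \subset S ->
  coset_reps Y SK (relS S K I) = Y :&: coset_reps W S I.
Proof.
move=> sKI sIS.
have asc w s : w \in Y -> s \in I :\: K ->
    (cox_length SK w < cox_length SK (w * r s)) = (s \notin N w^-1).
  move=> Yw /setDP[Is nKs]; have Ss := subsetP sIS s Is.
  have SKs : s \in S :\: K by rewrite inE nKs.
  have Yr := relgen_rel Ss.
  rewrite -(cox_lengthV relS_invol) ?gen_relS //.
  rewrite -(cox_lengthV relS_invol (w := w * _)) ?gen_relS ?(groupM Yw Yr) //.
  rewrite invMg; have -> : (r s)^-1 = r s.
    by apply/eqP; rewrite eq_invg_mul relgen_sqr.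
  by rewrite rel_left_ascent ?groupV.
apply/setP => w; rewrite inE in_setI; apply: andb_id2l => Yw.
have Ww := subsetP relW_sub w Yw; rewrite inE Ww /=.
apply/forall_inP/forall_inP => [asc_w s Is | asc_w _ /imsetP[s IKs ->]]; last first.
  by have [Is _] := setDP IKs; rewrite asc // -right_ascent ?asc_w // (subsetP sIS).
rewrite right_ascent ?(subsetP sIS) //; case: (boolP (s \in K)) => [Ks | nKs].
  by apply: relW_no_parabolic; rewrite ?groupV ?mem_gen.
have IKs : s \in I :\: K by rewrite inE nKs.
by rewrite -asc // asc_w // imset_f.
Qed.

Lemma conj_sub_self_opposed w I : I \subset S -> w \in W -> K :^ w \subset I -> K :^ w = K.
Proof.
move=> sIS Ww KwI; have [_ soK2] := soK; have := soK2 w^-1; rewrite groupV invgK.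
by apply=> //; apply: subset_trans KwI sIS.
Qed.

(** Let u be the representative of g.  As g normalizes K, u^-1 K u lies in
W_I, hence in I by [conj_gen_in], hence is K because K is self-opposed. *)
Lemma min_rep_rel I g : K \subset I -> I \subset S -> g \in Y -> min_rep I g \in Y.
Proof.
move=> sKI sIS Yg; have /relWP[Wg KgK _] := Yg; have := min_repP (min_rep I g) sIS Wg.
rewrite eqxx; set u := min_rep I g => /esym/andP[/(coset_repsP _ sIS)[Wu nu] Iu].
have KuI : K :^ u \subset I.
  apply/subsetP => _ /imsetP[k Kk ->]; apply: conj_gen_in => //.
    exact: subsetP sKS k Kk.
  have -> : k ^ u = (k ^ g) ^ (u^-1 * g)^-1 by rewrite -conjgM invMg invgK mulKVg.
  by rewrite groupJ ?groupV // mem_gen // (subsetP sKI) // -KgK memJ_conjg.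
rewrite -groupV; apply/relWP; rewrite groupV; split=> // [|s /(subsetP sKI)/nu//].
by rewrite -{1}(conj_sub_self_opposed sIS Wu KuI) conjsgK.
Qed.

(** * Solomon's formula in W(K) *)
Section Product.
Variables I J : {set gT}.
Hypotheses (sIS : I \subset S) (sJS : J \subset S) (sKI : K \subset I).

Let X := coset_reps W S.

(** The minimal element d of W_I v is again in X_J: a right descent j of d that
is not one of v = ad would give an inversion of d lying in W_I. *)
Lemma double_rep v : v \in Y :&: X J ->
  (min_rep I v^-1)^-1 \in Y :&: ((X I)^-1 :&: X J).
Proof.
case/setIP=> Yv /(coset_repsP _ sJS)[Wv nv].
have YVv : v^-1 \in Y by rewrite groupV.
have Yd := min_rep_rel sKI sIS YVv; have WVv := subsetP relW_sub _ YVv.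
have := min_repP (min_rep I v^-1) sIS WVv; rewrite eqxx.
set e := min_rep I v^-1 => /esym/andP[XIe Ie]; have [We ne] := coset_repsP _ sIS XIe.
rewrite in_setI groupV Yd in_setI mem_invg invgK XIe /=; apply/(coset_repsP _ sJS).
rewrite groupV; split=> // j Jj; rewrite invgK; apply/negP => je.
have := nv j Jj; rewrite -(mulKVg e v^-1) invM ?(subsetP (sub_parabolic sIS) _ Ie) //.
rewrite je negbK => /(inv_sub_parabolic sIS Ie) Ije.
have WVe : e^-1 \in W by rewrite groupV.
by have := no_descent_parabolic sIS WVe ne Ije; rewrite invV // conjgK je.
Qed.

(** For fixed d, both sides describe the pairs (u, a) with u in X_I and a in W_I
through v = ad, respectively w = uad.  The conditions v in X_J and uad in
X_(I^d cap J) agree since both say that no d j d^-1 in W_I, for j in J, is an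
inversion of a^-1, and by [conj_gen_in] such a d j d^-1 lies in I. *)
Lemma product_rep u d v :
    u \in Y :&: X I -> d \in Y :&: ((X I)^-1 :&: X J) ->
  (v \in Y :&: X J) && (min_rep I v^-1 == d^-1)
    = (u * v \in Y :&: X (I :^ d :&: J)) && (min_rep I (u * v * d^-1) == u).
Proof.
case/setIP=> Yu XIu /setIP[Yd /setIP[]]; rewrite mem_invg => XIVd XJd.
have sMS : I :^ d :&: J \subset S by apply: subset_trans sJS; apply: subsetIr.
rewrite !in_setI (groupMl _ Yu) -!andbA; apply: andb_id2l => Yv.
have [[Wu nu] [WVd nVd]] := (coset_repsP _ sIS XIu, coset_repsP _ sIS XIVd).
have [Wd nd] := coset_repsP _ sJS XJd; have Wv := subsetP relW_sub v Yv.
have [WVv Wuv] : v^-1 \in W /\ u * v * d^-1 \in W by rewrite groupV !groupM.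
rewrite !min_repP // -/X XIu XIVd /= invgK -!mulgA mulKg -groupV invMg invgK.
apply: andb_id2r => Ia; set a := v * d^-1 in Ia.
have WVu : u^-1 \in W by rewrite groupV.
have WVa : a^-1 \in W by rewrite groupV (subsetP (sub_parabolic sIS)).
have Dv : v^-1 = d^-1 * a^-1 by rewrite invMg invgK mulKg.
have invVv j : j \in J -> (j \in N v^-1) = (j ^ d^-1 \in N a^-1).
  by move=> Jj; rewrite Dv invM // (negPf (nd j Jj)).
have invVuv m : m \in I :^ d :&: J -> (m \in N (u * v)^-1) = (m ^ d^-1 \in N a^-1).
  case/setIP=> Im Jm; rewrite invMg invM // invVv // Dv conjgM.
  rewrite (negPf (no_descent_parabolic sIS WVu nu _)) ?addbF //.
  by rewrite groupJ ?groupV // mem_gen // -mem_conjg.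
apply/(coset_repsP _ sJS)/(coset_repsP _ sMS) => -[_ asc]; split; rewrite ?groupM //.
  by move=> m Mm; have [_ Jm] := setIP Mm; rewrite invVuv // -invVv // asc.
move=> j Jj; rewrite invVv //; apply/negP => ja.
have Ij : j ^ d^-1 \in I.
  apply: conj_gen_in => //; first exact: subsetP sJS j Jj.
  by apply: inv_sub_parabolic sIS _ ja; rewrite groupV.
have Mj : j \in I :^ d :&: J by rewrite inE Jj mem_conjg Ij.
by have := asc j Mj; rewrite invVuv // ja.
Qed.

Let D := Y :&: ((X I)^-1 :&: X J).

Local Open Scope ring_scope.

(** Group the terms uv by the minimal element d of W_I v; for fixed d the
products w = uv are grouped by u, which is the representative of w d^-1. *)
Lemma solomon_rel :
  (\sum_(u in Y :&: X I) gelt u) * (\sum_(v in Y :&: X J) gelt v)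
    = \sum_(d in D) \sum_(w in Y :&: X (I :^ d :&: J)) gelt w.
Proof.
rewrite GRing.mulr_suml.
transitivity (\sum_(u in Y :&: X I) \sum_(d in D)
  \sum_(v in Y :&: X J | min_rep I (v^-1)%g == (d^-1)%g) gelt (u * v)%g).
  apply: eq_bigr => u _; rewrite GRing.mulr_sumr.
  rewrite (partition_big (fun v => ((min_rep I v^-1)^-1)%g) (mem D)) => [|v];
    last exact: double_rep.
  apply: eq_bigr => d _; apply: eq_big => [v|v _]; last by rewrite geltM.
  by rewrite -(inj_eq invg_inj) invgK.
rewrite exchange_big; apply: eq_bigr => d Dd /=.
have Yd : d \in Y by case/setIP: Dd.
rewrite [RHS](partition_big (fun w => min_rep I (w * d^-1)%g) (mem (Y :&: X I)))
  => [|w]; last first.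
  case/setIP=> Yw _; have Ywd : (w * d^-1)%g \in Y by rewrite groupM ?groupV.
  have := min_repP (min_rep I (w * d^-1)%g) sIS (subsetP relW_sub _ Ywd).
  by rewrite eqxx => /esym/andP[XIu _]; rewrite /= in_setI min_rep_rel.
apply: eq_bigr => u XIu; rewrite [RHS](reindex_inj (mulgI u)) /=.
by apply: eq_bigl => v; apply: product_rep.
Qed.

End Product.

End SelfOpposed.

Local Open Scope ring_scope.

(** * Solomon's formula in W and independence of the basis elements *)
Lemma self_opposed0 : self_opposed W S set0.
Proof. by split=> [|w _ _]; rewrite ?sub0set // -[LHS]setU0 conj0g setU0. Qed.

Lemma relW0 : relW W S set0 = W.
Proof.
apply/setP => w; apply/(relWP self_opposed0)/idP => [[] // | Ww].
by split; rewrite ?conj0g // => s; rewrite inE.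
Qed.

Lemma solomon (I J : {set gT}) : I \subset S -> J \subset S ->
  descent_elt W S I * descent_elt W S J =
    \sum_(d in (coset_reps W S I)^-1%g :&: coset_reps W S J)
      descent_elt W S (I :^ d :&: J).
Proof.
move=> sIS sJS; have := solomon_rel self_opposed0 sIS sJS (sub0set I).
have sXW L : coset_reps W S L \subset W by apply/subsetP => w; rewrite inE => /andP[].
rewrite relW0 (setIidPr (sXW I)) (setIidPr (sXW J)).
rewrite [W :&: (_ :&: _)](setIidPr _); last by apply: subset_trans (sXW J); apply: subsetIr.
by move=> ->; apply: eq_bigr => d _; rewrite (setIidPr (sXW _)).
Qed.

Lemma sum_geltE (A : {set gT}) w : (\sum_(u in A) gelt u) w = (w \in A)%:R.
Proof.
have evD (f g : grpalg gT) : (f + g) w = f w + g w by rewrite ffunE.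
have ev0 : (0 : grpalg gT) w = 0 by rewrite ffunE.
rewrite (big_morph (fun f : grpalg gT => f w) evD ev0).
case: (boolP (w \in A)) => [Aw | nAw].
  rewrite (bigD1 w) //= ffunE eqxx big1 ?addr0 // => u /andP[_ /negPf uw].
  by rewrite ffunE eq_sym uw.
rewrite big1 // => u Au; rewrite ffunE; case: eqP => // wu.
by rewrite wu Au in nAw.
Qed.

(** The generators in S that are inversions of w_(S - I) are those not in I. *)
Lemma longest_coset_reps (I J : {set gT}) : I \subset S -> J \subset S ->
  (longest S (S :\: I) \in coset_reps W S J) = (J \subset I).
Proof.
move=> sIS sJS; have sCS := subsetDl S I.
have Wx := subsetP (sub_parabolic sCS) _ (longest_mem (S :\: I)).
apply/(coset_repsP _ sJS)/subsetP => [[_ nx] j Jj | sJI]; last split=> // j Jj.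
  have := nx j Jj; rewrite longest_invol // inv_longest //; apply: contraR => nIj.
  by rewrite mem_parabolic_refl // inE nIj (subsetP sJS).
rewrite longest_invol // inv_longest //; apply/negP.
move=> /(subsetP (parabolic_refl_sub _)) /(gen_in_parabolic sCS (subsetP sJS j Jj)).
by rewrite inE sJI.
Qed.

(** Evaluating a linear relation at w_(S - I) leaves the coefficients indexed by
the subsets of I. *)
Lemma descent_elt_free :
  free [tuple descent_elt W S (enum_val i) | i < #|powerset S|].
Proof.
apply/freeP => k sum0 i.
have sub (j : 'I_#|powerset S|) : enum_val j \subset S by rewrite -powersetE enum_valP.
have [n] := ubnP #|enum_val i|; elim: n i => // n IHn i lein.
pose x := longest S (S :\: enum_val i).
have := congr1 (fun f : grpalg gT => f x) sum0.
have evD (f g : grpalg gT) : (f + g) x = f x + g x by rewrite ffunE.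
have ev0 : (0 : grpalg gT) x = 0 by rewrite ffunE.
rewrite ev0 (big_morph (fun f : grpalg gT => f x) evD ev0).
have coef j : (k j *: [tuple descent_elt W S (enum_val i) | i < #|powerset S|]`_j) x
    = k j * (enum_val j \subset enum_val i)%:R.
  by rewrite -tnth_nth tnth_mktuple ffunE sum_geltE longest_coset_reps.
rewrite (bigD1 i) //= coef subxx mulr1 big1 ?addr0 // => j ji.
rewrite coef; case: (boolP (_ \subset _)) => [sji|_]; last by rewrite mulr0.
rewrite IHn ?mul0r // -ltnS (leq_trans _ lein) // ltnS proper_card // properEneq sji.
by rewrite (inj_eq enum_val_inj) ji.
Qed.

Lemma descent_map_exists (F : {set gT} -> grpalg gT) :
  exists f : 'End(grpalg gT), forall I, I \subset S -> f (descent_elt W S I) = F I.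
Proof.
pose X := [tuple descent_elt W S (enum_val i) | i < #|powerset S|].
pose fX := [tuple F (enum_val i) | i < #|powerset S|].
have [f /(_ descent_elt_free)] := linear_of_free X fX.
rewrite !size_tuple => /(_ erefl) fE; exists (linfun f) => I sIS; rewrite lfunE /=.
have PI : I \in powerset S by rewrite inE.
have := congr1 (fun e : seq (grpalg gT) => e`_(enum_rank_in PI I)) fE.
rewrite (nth_map 0) ?size_tuple // -!tnth_nth !tnth_mktuple.
by rewrite enum_rankK_in.
Qed.

Lemma descent_algebraP (x : grpalg gT) : x \in descent_algebra W S ->
  exists c : {set gT} -> rat, x = \sum_(I in powerset S) c I *: descent_elt W S I.
Proof.
case/memv_sumP=> v Hv ->; pose c I := coord [tuple descent_elt W S I] ord0 (v I).
exists c; apply: eq_bigr => I PI; have /= := Hv I PI; rewrite -span_seq1.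
by move/coord_span; rewrite big_ord1.
Qed.

(** * The map psi *)
Section Psi.
Variable K : {set gT}.
Hypothesis soK : self_opposed W S K.
Variable psi : 'End(grpalg gT).
Hypothesis psiE : is_psi W S K psi.

Let Y := relW W S K.
Let SK := relS S K S.
Let sKS : K \subset S. Proof. by case: soK. Qed.

Lemma psi_genE I : I \subset S -> psi (descent_elt W S I) =
  if K \subset I then \sum_(w in Y :&: coset_reps W S I) gelt w else 0.
Proof.
move=> sIS; rewrite psiE //; case: ifP => // sKI.
by rewrite /descent_elt rel_coset_reps.
Qed.

(** If K lies in I^d, then d K d^-1 lies in I, hence in S, so that it is K. *)
Lemma sub_conj_rel (I J : {set gT}) d : I \subset S -> J \subset S ->
    d \in (coset_reps W S I)^-1%g :&: coset_reps W S J ->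
  (K \subset (I :^ d :&: J)%g) = [&& K \subset I, K \subset J & d \in Y].
Proof.
move=> sIS sJS /setIP[]; rewrite mem_invg => /(coset_repsP _ sIS)[WVd nVd] _.
rewrite subsetI; have Wd : d \in W by rewrite -groupV.
apply/andP/and3P => [[sKId sKJ] | [sKI sKJ /(relWP soK)[_ KdK _]]]; last first.
  by rewrite -{1}KdK conjSg.
have sKVd : K :^ d^-1 \subset I by rewrite -(conjSg _ _ d) conjsgKV.
have KVd := conj_sub_self_opposed soK sIS WVd sKVd.
have sKI : K \subset I by rewrite -KVd.
split=> //; apply/(relWP soK); rewrite -{1}KVd conjsgKV; split=> // s Ks.
by rewrite -[d]invgK nVd ?(subsetP sKI).
Qed.

Lemma psi_genM (I J : {set gT}) : I \subset S -> J \subset S ->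
  psi (descent_elt W S I * descent_elt W S J) =
    psi (descent_elt W S I) * psi (descent_elt W S J).
Proof.
move=> sIS sJS; rewrite solomon // linear_sum /=.
have psi_term d : d \in (coset_reps W S I)^-1%g :&: coset_reps W S J ->
  psi (descent_elt W S (I :^ d :&: J)%g) = if [&& K \subset I, K \subset J & d \in Y]
    then \sum_(w in Y :&: coset_reps W S (I :^ d :&: J)%g) gelt w else 0.
  move=> XIJd; rewrite psi_genE ?(subset_trans (subsetIr _ _)) //.
  by rewrite sub_conj_rel.
rewrite (eq_bigr _ psi_term) !psi_genE //.
have [sKI | _] := boolP (K \subset I); last by rewrite big1 ?mul0r.
have [sKJ | _] := boolP (K \subset J); last by rewrite big1 ?mulr0.
rewrite (solomon_rel soK) //= -big_mkcondr /=.
by apply: eq_bigl => d; rewrite [RHS]in_setI andbC.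
Qed.

Lemma coset_repsS : coset_reps W S S = [set 1%g].
Proof.
apply/setP => w; rewrite [RHS]inE; apply/(coset_repsP _ (subxx S))/eqP => [[Ww nw] | ->].
  have WVw : w^-1%g \in W by rewrite groupV.
  by apply/eqP; rewrite -eq_invg1 (parabolic_descent (subxx S) WVw nw).
by rewrite group1; split=> // s _; rewrite invg1 inv1.
Qed.

Lemma descent_eltS : descent_elt W S S = 1.
Proof. by rewrite /descent_elt coset_repsS big_set1. Qed.

Lemma psi1 : psi 1 = 1.
Proof.
rewrite -{1}descent_eltS psi_genE // sKS coset_repsS.
have Y1 : [set 1%g] \subset Y by rewrite sub1set (group1 (relW_group soK)).
by rewrite (setIidPr Y1) big_set1.
Qed.

Lemma psi_ahom : ahom_in (descent_algebra W S) psi.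
Proof.
apply/ahom_inP; split=> [x y|]; last exact: psi1.
move=> /descent_algebraP[c ->] /descent_algebraP[c' ->].
(* Generalizing keeps linear_sum from splitting the basis elements. *)
move: psi_genM; move: (descent_elt W S) => X psiM.
rewrite mulr_suml !linear_sum mulr_suml; apply: eq_bigr => I; rewrite inE => sIS.
rewrite mulr_sumr !linear_sum mulr_sumr; apply: eq_bigr => J; rewrite inE => sJS /=.
by rewrite -scalerAl -scalerAr !linearZ /= psiM // -scalerAl -scalerAr.
Qed.

(** Every subset of S(K) is I(K) for some I containing K. *)
Lemma psi_limg : (psi @: descent_algebra W S)%VS = descent_algebra Y SK.
Proof.
apply/eqP; rewrite eqEsubv limg_sum; apply/andP; split; apply/subv_sumP => I.
  rewrite inE => sIS; rewrite limg_line psiE //; case: ifP => _; last first.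
    by rewrite -memvE mem0v.
  by apply: (sumv_sup (relS S K I)) => //; rewrite inE imsetS ?setSD.
rewrite inE => sISK; pose J := K :|: [set s in S :\: K | relgen S K s \in I].
have sJS : J \subset S.
  by rewrite subUset sKS; apply/subsetP => s; rewrite inE => /andP[/setDP[]].
apply: (sumv_sup J); first by rewrite inE.
rewrite limg_line psiE // subsetUl; suff -> : relS S K J = I by [].
apply/setP => t; apply/imsetP/idP => [[s] | It].
  by rewrite !inE => /andP[/negPf->] /= /andP[_ Is] ->.
have /imsetP[s SKs Dt] := subsetP sISK t It; exists s => //.
by have:= SKs; rewrite !inE -Dt It => /andP[-> ->]; rewrite orbT.
Qed.

End Psi.

End Inversions.

Theorem theorem4p20 (gT : finGroupType) (W S K : {set gT}) :
  coxeter_system W S -> self_opposed W S K ->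
  (exists psi : 'End(grpalg gT), is_psi W S K psi) /\
  forall psi : 'End(grpalg gT), is_psi W S K psi ->
    ahom_in (descent_algebra W S) psi /\
    (psi @: descent_algebra W S)%VS =
      descent_algebra (relW W S K) (relS S K S).
Proof.
move=> /coxeter_inversion_cocycle[-> [N cocN]] soK; split.
  exact: (descent_map_exists cocN).
move=> psi psiE; split; first exact: (psi_ahom cocN soK psiE).
exact: (psi_limg soK psiE).
Qed.
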